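(* Let $m\ge1$, $k\ge m$ and $h$ be integers. The generating function $\sum_{n\ge0}a(n)q^n$, where $a(n)$ is the number of partitions $\lambda$ of $n$ with an $h$-fixed hook in the $m$th column arising from a part of size $k$ (i.e. there is a row $s$ with $\lambda_s=k$ and $h_{s,m}(\lambda)=s+h$), is \[ \sum_{s=k-h-m+1}^{\infty}\frac{q^{s(k+m)+m(h-k+m-1)}}{(q;q)_{s-1}(q;q)_{m-1}}\binom{s+h-1}{k-m}_q =\sum_{s=0}^{\infty}\frac{q^{s(k+m)+k(k-h-m+1)}}{(q;q)_{s+k-h-m}(q;q)_{m-1}}\binom{s+k-m}{k-m}_q . \]
   Context: For a partition $\lambda$ with conjugate $\lambda'$, $h_{i,j}(\lambda)=\lambda_i+\lambda'_j-i-j+1$ is the hook length of cell $(i,j)$, $j\le\lambda_i$. Notation: $(a;b)_n=\prod_{t=0}^{n-1}(1-ab^t)$, and the Gaussian binomial coefficient is $\binom{a}{b}_q=\frac{(q;q)_a}{(q;q)_b(q;q)_{a-b}}$, with the standard conventions that $1/(q;q)_j=0$ for $j<0$ and $\binom{a}{b}_q=0$ unless $0\le b\le a$. *)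

(* Defs.v *)
From HB Require Import structures.
From mathcomp Require Import all_boot all_order all_algebra.
From mathcomp Require Import boolp.

Set Implicit Arguments.
Unset Strict Implicit.
Unset Printing Implicit Defensive.

Import Order.TTheory GRing.Theory Num.Theory.
Local Open Scope ring_scope.

(** * The ring R[[q]] of formal power series *)

(* A record rather than a synonym of [nat -> R], so that the Cauchy product
   cannot be confused with a pointwise product of functions. *)
Record fps (R : Type) := Fps { coefs : nat -> R }.

HB.instance Definition _ R := gen_eqMixin (fps R).
HB.instance Definition _ R := gen_choiceMixin (fps R).

Lemma fpsP (R : Type) (f g : fps R) :
  (forall n, coefs f n = coefs g n) -> f = g.
Proof. by case: f g => [f] [g] /= /funext ->. Qed.

Section FpsRing.
Variable R : comUnitRingType.
Implicit Types f g h : fps R.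

Definition fps0 : fps R := Fps (fun=> 0).
Definition fps1 : fps R := Fps (fun n => (n == 0%N)%:R).
Definition fpsN f : fps R := Fps (fun n => - coefs f n).
Definition fpsD f g : fps R := Fps (fun n => coefs f n + coefs g n).
Definition fpsM f g : fps R :=
  Fps (fun n => \sum_(i < n.+1) coefs f i * coefs g (n - i)).

Lemma fpsDA : associative fpsD.
Proof. by move=> f g h; apply: fpsP => n /=; rewrite addrA. Qed.

Lemma fpsDC : commutative fpsD.
Proof. by move=> f g; apply: fpsP => n /=; rewrite addrC. Qed.

Lemma fps0D : left_id fps0 fpsD.
Proof. by move=> f; apply: fpsP => n /=; rewrite add0r. Qed.

Lemma fpsND : left_inverse fps0 fpsN fpsD.
Proof. by move=> f; apply: fpsP => n /=; rewrite addNr. Qed.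

HB.instance Definition _ :=
  GRing.isZmodule.Build (fps R) fpsDA fpsDC fps0D fpsND.

Definition fps_trunc n f : {poly R} := \poly_(i < n) coefs f i.

Lemma coefs_mul_trunc N n f g : (n < N)%N ->
  coefs (fpsM f g) n = (fps_trunc N f * fps_trunc N g)`_n.
Proof.
move=> ltnN; rewrite coefM /=; apply: eq_bigr => i _.
by rewrite !coef_poly (leq_ltn_trans (leq_ord i) ltnN)
           (leq_ltn_trans (leq_subr i n) ltnN).
Qed.

Lemma fpsMC : commutative fpsM.
Proof.
by move=> f g; apply: fpsP => n; rewrite !(@coefs_mul_trunc n.+1) // mulrC.
Qed.

Lemma fpsMA : associative fpsM.
Proof.
move=> f g h; apply: fpsP => n; pose T := fps_trunc n.+1.
have -> : coefs (fpsM f (fpsM g h)) n = (T f * (T g * T h))`_n.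
  rewrite coefM; apply: eq_bigr => i _.
  by rewrite coef_poly ltn_ord (@coefs_mul_trunc n.+1) // ltnS leq_subr.
rewrite mulrA coefM; apply: eq_bigr => i _.
by rewrite (@coefs_mul_trunc n.+1) // coef_poly ltnS leq_subr.
Qed.

Lemma fps1M : left_id fps1 fpsM.
Proof.
move=> f; apply: fpsP => n /=.
by rewrite big_ord_recl big1 /= ?mul1r ?addr0 ?subn0 // => i _; rewrite mul0r.
Qed.

Lemma fpsMDl : left_distributive fpsM fpsD.
Proof.
move=> f g h; apply: fpsP => n /=.
by rewrite -big_split; apply: eq_bigr => i _; rewrite mulrDl.
Qed.

Lemma fps1_neq0 : fps1 != 0.
Proof.
by apply/eqP => /(congr1 (fun f => coefs f 0)) /= /eqP; rewrite oner_eq0.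
Qed.

HB.instance Definition _ := GRing.Zmodule_isComNzRing.Build (fps R)
  fpsMA fpsMC fps1M fpsMDl fps1_neq0.

Definition fps_unit : {pred fps R} := [pred f | coefs f 0 \is a GRing.unit].

(* The first [n] coefficients of 1/f, by solving f * (1/f) = 1 degree by
   degree. *)
Fixpoint fps_inv_seq f n : seq R :=
  if n is n'.+1 then
    let s := fps_inv_seq f n' in
    rcons s ((coefs f 0)^-1 *
             ((n' == 0%N)%:R - \sum_(i < n') s`_i * coefs f (n' - i)))
  else [::].

Definition fpsV f : fps R :=
  if f \in fps_unit then Fps (fun n => (fps_inv_seq f n.+1)`_n) else f.

Lemma size_fps_inv_seq f n : size (fps_inv_seq f n) = n.
Proof. by elim: n => //= n IHn; rewrite size_rcons IHn. Qed.

Lemma nth_fps_inv_seq f n i : (i < n)%N ->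
  (fps_inv_seq f n)`_i = (fps_inv_seq f i.+1)`_i.
Proof.
elim: n => // n IHn; rewrite ltnS leq_eqVlt => /predU1P[-> // | ltin].
by rewrite [in LHS]/= nth_rcons size_fps_inv_seq ltin IHn.
Qed.

Lemma fpsVM : {in fps_unit, left_inverse 1 fpsV *%R}.
Proof.
move=> f Uf; apply: fpsP => n; rewrite /fpsV Uf [LHS]/=.
rewrite big_ord_recr /= subnn nth_rcons size_fps_inv_seq ltnn eqxx.
rewrite mulrAC mulVr // mul1r addrC.
under [X in _ + X]eq_bigr => i _ do rewrite -[rcons _ _]/(fps_inv_seq f i.+1)
  -(nth_fps_inv_seq f (ltn_ord i)).
by rewrite subrK.
Qed.

Lemma fps_unitPl f g : g * f = 1 -> fps_unit f.
Proof.
move=> /(congr1 (fun f => coefs f 0)) /=; rewrite big_ord1 subn0 => gf1.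
by apply/unitrP; exists (coefs g 0); split=> //; rewrite mulrC.
Qed.

Lemma fpsV_out : {in [predC fps_unit], fpsV =1 id}.
Proof. by move=> f /negbTE nUf; rewrite /fpsV nUf. Qed.

HB.instance Definition _ := GRing.ComNzRing_hasMulInverse.Build (fps R)
  fpsVM fps_unitPl fpsV_out.

Definition fpsX : fps R := Fps (fun n => (n == 1%N)%:R).

(* [f] is the sum of the [u i], i >= 0, in the q-adic topology: every
   coefficient of the partial sums is eventually that of [f]. *)
Definition fps_sums_to (u : nat -> fps R) f : Prop :=
  forall n, exists N, forall M, (N <= M)%N ->
    coefs (\sum_(i < M) u i) n = coefs f n.

End FpsRing.

Notation "''q'" := (fpsX int) : ring_scope.

(** * q-series *)

Definition qpoch (A : pzRingType) (a b : A) (n : nat) : A :=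
  \prod_(t < n) (1 - a * b ^+ t).

(* 1/(q;q)_j for an integer j, with the convention that it is 0 for j < 0. *)
Definition inv_qpoch (j : int) : fps int :=
  if j is Posz n then (qpoch 'q 'q n)^-1 else 0.

Definition qbinom (a b : int) : fps int :=
  if 0 <= b <= a then qpoch 'q 'q `|a|%N * inv_qpoch b * inv_qpoch (a - b)
  else 0.

(** * Partitions *)

Definition is_partition (n : nat) (la : seq nat) : bool :=
  [&& sorted geq la, 0%N \notin la & sumn la == n].

(* Rows and columns are numbered from 1; [part la i] is 0 past the last part. *)
Definition part (la : seq nat) (i : nat) : nat := nth 0%N la i.-1.

Definition conj_part (la : seq nat) (j : nat) : nat :=
  count (fun p => j <= p)%N la.

Definition hook (la : seq nat) (i j : nat) : int :=
  (part la i)%:Z + (conj_part la j)%:Z - i%:Z - j%:Z + 1.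

Definition has_fixed_hook (m k : nat) (h : int) (la : seq nat) : bool :=
  has (fun s => (part la s == k) && (hook la s m == s%:Z + h))
      (iota 1 (size la)).

(* A partition of [n] has at most [n] parts, each at most [n], so all of them
   occur in the finite type of sequences of length at most [n] over 'I_n.+1. *)
Definition fixed_hook_count (m k : nat) (h : int) (n : nat) : nat :=
  #|[set la : {bseq n of 'I_n.+1} |
      is_partition n [seq val p | p <- la] &&
      has_fixed_hook m k h [seq val p | p <- la]]|.

Definition fixed_hook_gf (m k : nat) (h : int) : fps int :=
  Fps (fun n => (fixed_hook_count m k h n)%:Z).

(** * The two series *)

(* The exponents of 'q below can be negative, where [^] yields an irrelevant
   value since 'q is not invertible in int[[q]].  In the range of summation of each
   series (s >= k-h-m+1 and s >= 0 respectively) this only happens when the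
   term vanishes because of the factor 1/(q;q)_j with j < 0. *)
Definition term1 (m k : nat) (h s : int) : fps int :=
  'q ^ (s * (k%:Z + m%:Z) + m%:Z * (h - k%:Z + m%:Z - 1))
  * inv_qpoch (s - 1) * inv_qpoch (m%:Z - 1)
  * qbinom (s + h - 1) (k%:Z - m%:Z).

Definition term2 (m k : nat) (h s : int) : fps int :=
  'q ^ (s * (k%:Z + m%:Z) + k%:Z * (k%:Z - h - m%:Z + 1))
  * inv_qpoch (s + k%:Z - h - m%:Z) * inv_qpoch (m%:Z - 1)
  * qbinom (s + k%:Z - m%:Z) (k%:Z - m%:Z).

(* Main.v *)
(** If row s has length k and the hook of cell (s, m) equals s + h, let r be the
    number of rows below row s that reach column m.  The hook condition then
    reads s = r + k - h - m + 1, and r is determined by the partition.  For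
    fixed r, the partition consists of s - 1 parts >= k, contributing
    q^(k(s-1)) / (q;q)_(s-1), then the part k, then r parts in [m, k],
    contributing q^(mr) binom(r+k-m, r)_q, and finally parts < m, contributing
    1 / (q;q)_(m-1).  The product of these factors is the r-th term of the
    second series, and shifting the index gives the first series.  The three
    factors are computed by removing an extremal part. *)

Require Import Defs.
From mathcomp Require Import all_boot all_order all_algebra.
From mathcomp Require Import zify ring.
Import GRing.Theory.
Local Open Scope ring_scope.

Implicit Types (la a b : seq nat) (P Q R : pred (seq nat)).
Implicit Types d k m n r s x : nat.

(** * Generating functions of classes of compositions *)

Definition comps n : seq (seq nat) :=
  [seq la <- [seq map val la | la : {bseq n of 'I_n.+1}]
     | (0%N \notin la) && (sumn la == n)].

Lemma comps_uniq n : uniq (comps n).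
Proof.
rewrite filter_uniq // map_inj_uniq ?enum_uniq // => x y /(inj_map val_inj).
exact: val_inj.
Qed.

Lemma leq_sumn la x : x \in la -> (x <= sumn la)%N.
Proof.
elim: la => //= y la IH; rewrite inE => /predU1P[->|/IH]; first exact: leq_addr.
by move/leq_trans; apply; apply: leq_addl.
Qed.

Lemma leq_size_sumn la : 0%N \notin la -> (size la <= sumn la)%N.
Proof. by elim: la => //= y la IH; rewrite inE negb_or => /andP[y0 /IH]; lia. Qed.

Lemma mem_comps n la : (la \in comps n) = (0%N \notin la) && (sumn la == n).
Proof.
rewrite mem_filter; case: (boolP (_ && (_ == n))) => //= /andP[la0 /eqP sla].
have szla : (size (map (@inord n) la) <= n)%N.
  by rewrite size_map -sla leq_size_sumn.
apply/mapP; exists (Bseq szla); first by rewrite mem_enum.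
rewrite /= -map_comp -[LHS]map_id; apply/eq_in_map => x xla /=.
by rewrite inordK // ltnS -sla leq_sumn.
Qed.

Lemma mem_filter_comps P n la :
  (la \in filter P (comps n)) = [&& P la, 0%N \notin la & sumn la == n].
Proof. by rewrite mem_filter mem_comps. Qed.

(** Sortedness is left to [P], so that cutting a partition in two stays inside the same family of
    lists. *)
Definition gf P : fps int := Fps (fun n => (count P (comps n))%:Z).

Lemma eq_gf P Q : (forall la, 0%N \notin la -> P la = Q la) -> gf P = gf Q.
Proof.
move=> eqPQ; apply: fpsP => n /=; congr Posz; apply: eq_in_count => la.
by rewrite mem_comps => /andP[/eqPQ].
Qed.

(** Adding the indicators as naturals encodes both the covering and the disjointness of [Q] and
    [R]. *)
Lemma gfU {P Q R} : (forall la, (P la : nat) = (Q la + R la)%N) ->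
  gf P = gf Q + gf R.
Proof.
move=> PQR; apply: fpsP => n /=; rewrite -PoszD; congr Posz.
by elim: (comps n) => //= la s ->; rewrite PQR; lia.
Qed.

Lemma gf0 P : (forall la, P la = false) -> gf P = 0.
Proof.
move=> P0; apply: fpsP => n /=.
by rewrite (eq_count (a2 := pred0)) ?count_pred0.
Qed.

(* The heads all have the same length [d], so the splitting is unique. *)
Lemma gf_cat d {P Q R} :
    (forall la, P la -> (d <= size la)%N) -> (forall a, Q a -> size a = d) ->
    (forall a b, size a = d -> P (a ++ b) = Q a && R b) ->
  gf P = gf Q * gf R.
Proof.
move=> dP dQ PQR; apply: fpsP => n /=.
under eq_bigr => i _ do rewrite -PoszM.
rewrite -(big_morph Posz PoszD (erefl _)); congr Posz.
(* Classify by the weight [i] of the first [d] entries, to match the Cauchy product term by term. *)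
have -> : count P (comps n) =
    (\sum_(i < n.+1) count (fun la => P la && (sumn (take d la) == i)) (comps n))%N.
  under eq_bigr => i _ do rewrite -sum1_count big_mkcond.
  rewrite exchange_big -sum1_count big_mkcond big_seq [RHS]big_seq /=.
  apply: eq_bigr => la; rewrite mem_comps => /andP[_ /eqP sla].
  have lt_n : (sumn (take d la) < n.+1)%N.
    by rewrite ltnS -sla -[in leqRHS](cat_take_drop d la) sumn_cat leq_addr.
  rewrite (bigD1 (Ordinal lt_n)) //= eqxx andbT big1 ?addn0 // => i ni.
  by rewrite ifN //; apply: contra ni => /andP[_ /eqP E]; apply/eqP/val_inj.
(* For a fixed head weight, concatenation is a bijection from pairs (head, tail) to the lists
   counted. *)
apply: eq_bigr => i _; rewrite -!size_filter -(size_allpairs cat).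
apply/perm_size/uniq_perm.
- by rewrite filter_uniq // comps_uniq.
- apply: allpairs_uniq; [exact/filter_uniq/comps_uniq.. |].
  move=> _ _ /allpairsPdep[a [b [+ _ ->]]] /allpairsPdep[a' [b' [+ _ ->]]] /=.
  rewrite !mem_filter_comps => /andP[/dQ sa _] /andP[/dQ sa' _] /eqP.
  by rewrite eqseq_cat ?sa ?sa' // => /andP[/eqP-> /eqP->].
move=> la; apply/idP/allpairsP => [|[[a b] /=]].
  rewrite mem_filter_comps => /andP[/andP[Pla /eqP si] /andP[la0 /eqP sn]].
  have szd : size (take d la) = d by rewrite size_takel // dP.
  have := PQR _ (drop d la) szd; rewrite cat_take_drop Pla => /esym/andP[Qa Rb].
  exists (take d la, drop d la); rewrite /= cat_take_drop.
  move: la0 sn; rewrite -{1 2}(cat_take_drop d la) mem_cat negb_or sumn_cat si.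
  move=> /andP[a0 b0] sn.
  by rewrite !mem_filter_comps Qa Rb a0 b0 si -[X in (X - i)%N]sn addKn !eqxx.
rewrite !mem_filter_comps.
case=> /and3P[Qa a0 /eqP sa] /and3P[Rb b0 /eqP sb] ->.
rewrite PQR ?dQ // Qa Rb take_size_cat ?dQ // sa eqxx mem_cat negb_or a0 b0.
by rewrite sumn_cat sa sb subnKC ?eqxx // -ltnS.
Qed.

(** * Coefficients of powers of q, and q-factorials *)

Lemma coefsB (f g : fps int) n : coefs (f - g) n = coefs f n - coefs g n.
Proof. by []. Qed.

Lemma coefs_mulX (f : fps int) n :
  coefs ('q * f) n = if n is n'.+1 then coefs f n' else 0.
Proof.
case: n => [|n] /=; first by rewrite big_ord1 mul0r.
rewrite big_ord_recl mul0r add0r big_ord_recl /= mul1r subn1 big1 ?addr0 //.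
by move=> i _; rewrite mul0r.
Qed.

Lemma coefs_mulXn (f : fps int) c n : (n < c)%N -> coefs ('q ^+ c * f) n = 0.
Proof.
elim: c n => // c IH [|n] ltnc; rewrite exprS -mulrA coefs_mulX //.
exact: IH.
Qed.

Lemma coefs_Xn c n : coefs ('q ^+ c) n = (n == c)%:R.
Proof.
elim: c n => [|c IH] n; first by rewrite expr0.
by rewrite exprS coefs_mulX; case: n => [|n]; rewrite ?IH.
Qed.

Lemma gf_nil : gf (pred1 [::]) = 1.
Proof.
apply: fpsP => n /=; rewrite count_uniq_mem ?comps_uniq // mem_comps /=.
by rewrite eq_sym; case: eqP.
Qed.

Lemma gf_seq1 k : (0 < k)%N -> gf (pred1 [:: k]) = 'q ^+ k.
Proof.
move=> k0; apply: fpsP => n; rewrite coefs_Xn /=.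
rewrite count_uniq_mem ?comps_uniq // mem_comps /= inE addn0 eq_sym.
by rewrite -lt0n k0 (eq_sym k); case: eqP.
Qed.

Notation qfact := (qpoch 'q 'q).

Lemma qfact0 : qfact 0 = 1.
Proof. exact: big_ord0. Qed.

Lemma qfactS n : qfact n.+1 = qfact n * (1 - 'q ^+ n.+1).
Proof. by rewrite /qpoch big_ord_recr exprS. Qed.

Lemma qfact_unit n : qfact n \is a GRing.unit.
Proof.
elim: n => [|n IH]; first by rewrite qfact0 unitr1.
by rewrite qfactS unitrM IH /= !inE /= coefs_Xn.
Qed.

Lemma qfactVS n : (1 - 'q ^+ n.+1) * (qfact n.+1)^-1 = (qfact n)^-1.
Proof.
apply: (mulrI (qfact_unit n)); rewrite mulrV ?qfact_unit // mulrA -qfactS.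
by rewrite mulrV // qfact_unit.
Qed.

(** * Parts between two bounds: Gaussian binomials *)

Lemma sorted_geq_cat a b :
  sorted geq (a ++ b) = [&& allrel geq a b, sorted geq a & sorted geq b].
Proof.
have geqT : transitive geq by move=> x y z yx zx; apply: leq_trans yx.
by rewrite !(sorted_pairwise geqT) pairwise_cat.
Qed.

Lemma sorted_geq_cons x a :
  sorted geq (x :: a) = all (geq x) a && sorted geq a.
Proof. by rewrite -cat1s sorted_geq_cat allrel1l /=. Qed.

Definition box r m k la :=
  [&& size la == r, sorted geq la, all (leq m) la & all (geq k) la].

Lemma gf_box0 m k : gf (box 0 m k) = 1.
Proof. by rewrite -gf_nil; apply: eq_gf => -[]. Qed.

Lemma gf_box_lt r m k : (k < m)%N -> gf (box r.+1 m k) = 0.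
Proof.
move=> km; apply: gf0 => -[//|x la]; rewrite /box /=.
by apply/negP => /and4P[_ _ /andP[? _] /andP[? _]]; lia.
Qed.

(** Split on whether the first, hence largest, part equals [k.+1]; if so, remove it. *)
Lemma gf_boxS r m k : (m <= k.+1)%N ->
  gf (box r.+1 m k.+1) = 'q ^+ k.+1 * gf (box r m k.+1) + gf (box r.+1 m k).
Proof.
move=> mk; pose top la := box r.+1 m k.+1 la && (nth 0%N la 0 == k.+1).
rewrite -gf_seq1 // -(gf_cat 1%N (P := top)).
- apply: gfU => -[|x la]; rewrite /top // /box /= -/(sorted geq (x :: la)).
  rewrite sorted_geq_cons /=.
  rewrite eqSS; case: (size la == r) => //=.
  have allW : all (geq x) la -> (x <= k.+1)%N -> all (geq k.+1) la.
    by move=> /allP xla xk; apply/allP => y /xla /= /leq_trans; apply.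
  have allW' : all (geq x) la -> (x <= k)%N -> all (geq k) la.
    by move=> /allP xla xk; apply/allP => y /xla /= /leq_trans; apply.
  case: (all (geq x) la) allW allW' => //= allW allW'.
  case: (sorted geq la) => //=; case: (leqP m x) => //= mx.
  case: (all (leq m) la) => //=.
  rewrite -(ltnS x k).
  case: ltngtP => [xk|//|xk]; last by rewrite allW ?xk.
  by rewrite (allW isT (ltnW xk)) (allW' isT xk).
- by case=> // x la _.
- by move=> a /eqP->.
move=> [|x [|? ?]] b // _; rewrite /top /box [_ ++ _]/= sorted_geq_cons /=.
rewrite eqSS eqseq_cons andbT andbC; case: (eqVneq x k.+1) => //= ->.
by rewrite mk leqnn /=; case: (all (geq _) b); rewrite ?andbF ?andbT.
Qed.

(** The Gaussian binomial with denominators cleared, by induction on [r] and then on the width [a]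
    of the interval of allowed parts. At [a = 0] the second term of [gf_boxS] counts an empty
    class. *)
Lemma gf_box r m (a : nat) :
  gf (box r m.+1 (m.+1 + a)) * qfact r * qfact a
    = 'q ^+ (m.+1 * r) * qfact (r + a).
Proof.
elim: r a => [|r IHr] a; first by rewrite gf_box0 muln0 expr0 qfact0 mulr1.
elim: a => [|a IHa]; rewrite addSn gf_boxS ?leq_addr //.
  have := IHr 0%N; rewrite !addn0 gf_box_lt // qfact0 !mulr1 addr0 qfactS => IH.
  by rewrite mulrA -[_ * _ * qfact r]mulrA IH mulnS exprD; ring.
have := IHr a.+1; rewrite !addSn !addnS !qfactS in IHa * => IH.
(* Grouped so that both induction hypotheses apply. What remains is the q-Pascal rule [q^(a+1) (1 -
   q^(r+1)) + (1 - q^(a+1)) = 1 - q^(r+a+2)]. *)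
transitivity (('q ^+ (m + a).+2 * (1 - 'q ^+ r.+1)) *
   (gf (box r m.+1 (m + a).+2) * qfact r * (qfact a * (1 - 'q ^+ a.+1)))
   + (1 - 'q ^+ a.+1) * (gf (box r.+1 m.+1 (m + a).+1)
      * (qfact r * (1 - 'q ^+ r.+1)) * qfact a)); first by ring.
rewrite IH IHa mulnS.
have -> : (m + a).+2 = (m.+1 + a.+1)%N by lia.
have -> : (r + a).+2 = (r.+1 + a.+1)%N by lia.
by rewrite !exprD; ring.
Qed.

(** * A fixed number of parts, bounded below *)

Definition tall s k la := [&& size la == s, sorted geq la & all (leq k) la].

(** Split on whether the last, hence smallest, part equals [k]; if so, remove it. *)
Lemma gf_tallS s k : (0 < k)%N ->
  gf (tall s.+1 k) = gf (tall s k) * 'q ^+ k + gf (tall s.+1 k.+1).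
Proof.
move=> k0; pose bot la := tall s.+1 k la && (last 0%N la == k).
have allW la x : all (leq x) la -> (k <= x)%N -> all (leq k) la.
  by move=> /allP xla kx; apply/allP => y /xla; apply: leq_trans.
rewrite -gf_seq1 // -(gf_cat s (P := bot)).
- apply: gfU => la; case/lastP: la => [|la x] //.
  rewrite /bot /tall last_rcons -cats1 size_cat addn1 eqSS sorted_geq_cat.
  rewrite allrel1r !all_cat /= !andbT.
  case: (size la == s) => //=.
  have {}allW1 := allW la x.
  have allW2 y : (y < x)%N -> all (leq x) la -> all (leq y.+1) la.
    by move=> yx /allP xla; apply/allP => z /xla; apply: leq_trans.
  case: (all (geq^~ x) la) allW1 (allW2 k) => //= allW1 {}allW2.
  case: (sorted geq la) => //=.
  case: ltngtP => [kx|_|kx]; rewrite ?andbF //.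
    by rewrite (allW1 isT (ltnW kx)) (allW2 kx isT).
  by rewrite allW1 ?kx ?andbF.
- by move=> la /andP[/and3P[/eqP-> _ _] _].
- by move=> a /and3P[/eqP].
move=> a b sa; rewrite /bot /tall size_cat sa sorted_geq_cat all_cat.
case: b => [|x [|y b]].
- by rewrite addn0 ltn_eqF // !andbF.
- rewrite allrel1r addn1 last_cat /= !eqxx eqseq_cons !andbT.
  case: (eqVneq x k) => [->|]; rewrite ?andbF // leqnn !andbT /=.
  by rewrite -[all (geq^~ k) a]/(all (leq k) a) andbAC andbb andbC.
by rewrite !addnS gtn_eqF ?ltnS ?leq_addr //= eqseq_cons !andbF.
Qed.

Lemma coefs_gf_tall s k n : (n < k)%N -> coefs (gf (tall s.+1 k)) n = 0.
Proof.
move=> nk; congr Posz; apply/eqP; rewrite -leqn0 leqNgt -has_count.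
apply/hasPn => la; rewrite mem_comps => /andP[_ /eqP sn].
case: la sn => // x la sn; apply/negP => /and3P[_ _ /andP[kx _]].
by have := leq_sumn (x :: la) x (mem_head _ _); lia.
Qed.

Lemma gf_tall s k : (0 < k)%N ->
  gf (tall s k) = 'q ^+ (k * s) * (qfact s)^-1.
Proof.
elim: s k => [|s IH] k k0.
  by rewrite muln0 expr0 qfact0 invr1 mulr1 -gf_nil; apply: eq_gf => -[].
(* [E] does not depend on [k], but its coefficients below [k] vanish. *)
pose E k := gf (tall s.+1 k) - 'q ^+ (k * s.+1) * (qfact s.+1)^-1.
(* From [j] to [j.+1] the closed form loses [q^(j(s+1)) / (q;q)_s], exactly the first term of
   [gf_tallS]. *)
have ES j : (0 < j)%N -> E j = E j.+1.
  move=> j0; rewrite /E gf_tallS // IH // -qfactVS mulSn mulnS !exprD; ring.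
have EE j : E k = E (k + j)%N.
  elim: j => [|j ->]; first by rewrite addn0.
  by rewrite ES ?addnS // addn_gt0 k0.
apply/eqP; rewrite -subr_eq0 -/(E k); apply/eqP/fpsP => n.
rewrite (EE n.+1) coefsB coefs_gf_tall ?coefs_mulXn ?subrr //; last by lia.
by rewrite mulnS; lia.
Qed.

(** * Any number of parts, bounded above *)

Definition small m la := sorted geq la && all (geq m) la.

(** Removing one largest part [m.+1] stays in the class, as the number of parts is free; hence the
    same series on both sides. *)
Lemma gf_smallS m :
  gf (small m.+1) = 'q ^+ m.+1 * gf (small m.+1) + gf (small m).
Proof.
pose top la := small m.+1 la && (nth 0%N la 0 == m.+1).
rewrite -gf_seq1 // -(gf_cat 1%N (P := top)).
- apply: gfU => -[|x la]; rewrite /top /small // sorted_geq_cons /=.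
  have allW k : all (geq x) la -> (x <= k)%N -> all (geq k) la.
    by move=> /allP xla xk; apply/allP => y /xla /= /leq_trans; apply.
  case: (all (geq x) la) allW => //= allW.
  case: (sorted geq la) => //=.
  rewrite -(ltnS x m).
  case: ltngtP => [xk|//|xk]; last by rewrite allW ?xk.
  by rewrite (allW _ isT (ltnW xk)) (allW _ isT xk).
- by case=> // /andP[_].
- by move=> a /eqP->.
move=> [|x [|? ?]] b // _; rewrite /top /small [_ ++ _]/= sorted_geq_cons /=.
rewrite eqseq_cons andbT andbC; case: (eqVneq x m.+1) => //= ->.
by rewrite leqnn /= andbC andbA andbb andbC.
Qed.

Lemma gf_small m : gf (small m) = (qfact m)^-1.
Proof.
elim: m => [|m IH].
  (* [eq_gf] provides that zero is not an entry, which rules out nonempty lists of zeros. *)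
  rewrite qfact0 invr1 -gf_nil; apply: eq_gf => -[|x la] //.
  rewrite inE negb_or /small sorted_geq_cons /= => /andP[x0 _].
  by apply/negP => /and3P[_]; lia.
apply: (mulIr (qfact_unit m.+1)); rewrite mulVr ?qfact_unit // qfactS mulrCA.
transitivity (qfact m * (gf (small m.+1) - 'q ^+ m.+1 * gf (small m.+1))).
  by ring.
by rewrite {1}gf_smallS addrAC subrr add0r IH mulrV ?qfact_unit.
Qed.

(** * Cutting a partition at a distinguished row *)

(** Here [s] is the number of rows above the distinguished one, whose 1-based index is [s.+1]. For
    [m <= k] these [s.+1] rows all reach column [m], so [r] counts the rows below that do. *)
Definition hooked m k s r la :=
  [&& sorted geq la, nth 0%N la s == k & conj_part la m == (s + r).+1].

Definition below m k r la :=
  [&& sorted geq la, all (geq k) la & conj_part la m == r].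

Lemma conj_part_cat a b m :
  conj_part (a ++ b) m = (conj_part a m + conj_part b m)%N.
Proof. exact: count_cat. Qed.

Lemma all_conj_part m a : all (leq m) a = (conj_part a m == size a).
Proof. exact: all_count. Qed.

Lemma conj_part_eq0 m a : (conj_part a m == 0%N) = all (gtn m) a.
Proof.
rewrite -leqn0 leqNgt -has_count -all_predC; apply: eq_all => x /=.
by rewrite -ltnNge.
Qed.

(** In a sorted list the [r] entries exceeding [m] are the first [r], so the cut is made there. *)
Lemma gf_below m k r : (m < k)%N ->
  gf (below m.+1 k r) = gf (box r m.+1 k) * gf (small m).
Proof.
move=> mk; apply: (gf_cat r).
- by move=> la /and3P[_ _ /eqP<-]; apply: count_size.
- by move=> a /and4P[/eqP].
move=> a b sa; rewrite /below /box /small sorted_geq_cat all_cat conj_part_cat.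
rewrite sa eqxx /= (eq_all (a1 := geq m) (a2 := gtn m.+1)) //.
rewrite -conj_part_eq0 all_conj_part sa.
apply/idP/idP.
  move=> /and3P[/and3P[ab -> ->] /andP[-> _] sab].
  rewrite andbT /=; move: sab; rewrite -sa.
  have := count_size (leq m.+1) a; rewrite leq_eqVlt => /predU1P[|].
    by rewrite -/(conj_part a m.+1) => -> /eqP; lia.
  (* If some entry of the head were at most [m], sortedness would bound the whole tail by [m], and
     fewer than [r] entries would exceed [m]. *)
  rewrite -/(conj_part a m.+1) => lta.
  have : ~~ all (leq m.+1) a by rewrite all_conj_part ltn_eqF.
  case/allPn => x xa; rewrite -ltnNge => xm.
  suff /eqP-> : conj_part b m.+1 == 0%N by move/eqP; lia.
  rewrite conj_part_eq0; apply/allP => y yb /=.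
  by apply: leq_ltn_trans xm; apply: (allrelP ab).
move=> /andP[/and3P[-> /eqP ca ->] /andP[-> cb]].
rewrite ca (eqP cb) addn0 eqxx !andbT /=.
move: cb; rewrite conj_part_eq0 => /allP bm; apply/andP; split.
  apply/allrelP => x y xa /bm /= ym.
  have /allP/(_ x xa) : all (leq m.+1) a by rewrite all_conj_part ca sa.
  by apply: leq_trans; apply: ltnW.
by apply/allP => x /bm /=; lia.
Qed.

(** Two cuts: before the distinguished row, leaving a tail of type [hooked m k 0 r], and then just
    after it. *)
Lemma gf_hooked m k s r : (0 < m <= k)%N ->
  gf (hooked m k s r) = gf (tall s k) * ('q ^+ k * gf (below m k r)).
Proof.
move=> /andP[m0 mk]; have k0 : (0 < k)%N by apply: leq_trans mk.
have nth_size s' r' la : hooked m k s' r' la -> (s' < size la)%N.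
  by rewrite ltnNge => /and3P[_ /eqP n _]; apply/negP => /(nth_default 0%N); lia.
rewrite -gf_seq1 // -(gf_cat 1%N (P := hooked m k 0 r)).
- apply: (gf_cat s) => [la /nth_size /ltnW //|a /and3P[/eqP] //|a b sa].
  rewrite /hooked /tall sorted_geq_cat conj_part_cat nth_cat sa ltnn subnn.
  rewrite eqxx add0n /=; case: b => [|x b].
    by rewrite ltn_eqF ?andbF.
  case: (eqVneq (nth _ _ 0) k) => [/=xk|]; rewrite ?andbF //= {x}xk.
  case: (boolP (sorted geq a)) => _; rewrite ?andbF //=.
  rewrite -[path _ _ _]/(sorted geq (k :: b)).
  case: (boolP (sorted _ _)) => kb; rewrite ?andbF //= ?andbT.
  (* The leading [k] dominates the rest of the sorted tail, so comparing the head with [k]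
     suffices. *)
  have -> : allrel geq a (k :: b) = all (leq k) a.
    rewrite allrel_consr /=; case: (boolP (all _ a)) => //= /allP ak.
    apply/allrelP => x y /ak /= kx yb; apply: leq_trans kx.
    by move: kb; rewrite sorted_geq_cons => /andP[/allP/(_ y yb)].
  case: (boolP (all _ a)) => [/allP ka|//] /=.
  have /eqP-> : conj_part a m == s.
    by rewrite -sa -all_conj_part; apply/allP => x /ka /(leq_trans mk).
  by rewrite -addnS eqn_add2l.
- by move=> la /nth_size.
- by move=> a /eqP->.
move=> [|x [|? ?]] b // _.
rewrite /hooked /below [_ ++ _]/= sorted_geq_cons /= eqseq_cons andbT.
case: (eqVneq x k) => [->|]; rewrite ?andbF //= mk add1n eqSS.
by rewrite andbCA andbA.
Qed.

Lemma gf_hookedE m k s r : (0 < m <= k)%N ->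
  gf (hooked m k s r) = 'q ^+ (k * s.+1 + m * r) * (qfact s)^-1
    * (qfact m.-1)^-1 * (qfact (r + (k - m)) / qfact r / qfact (k - m)).
Proof.
case: m => // m mk; rewrite gf_hooked // gf_below // gf_small gf_tall; last first.
  by case/andP: mk => _; apply: leq_trans.
have := gf_box r m (k - m.+1); rewrite subnKC // => boxE.
have -> : gf (box r m.+1 k)
    = 'q ^+ (m.+1 * r) * (qfact (r + (k - m.+1)) / qfact r / qfact (k - m.+1)).
  apply: (mulIr (qfact_unit r)); apply: (mulIr (qfact_unit (k - m.+1))).
  rewrite boxE -!mulrA [qfact r * _]mulrC mulKr ?qfact_unit //.
  by rewrite mulVr ?qfact_unit // mulr1.
by rewrite mulnS !exprD /=; ring.
Qed.

(** * Fixed hooks, sorted by the number [r] of lower rows reaching the column *)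

Lemma fixed_hook_gfE m k h :
  fixed_hook_gf m k h = gf (fun la => sorted geq la && has_fixed_hook m k h la).
Proof.
apply: fpsP => n /=; congr Posz; rewrite -size_filter -filter_predI.
rewrite /fixed_hook_count cardE -(size_map (fun la : {bseq n of _} => map val la)).
apply/perm_size/uniq_perm.
- rewrite map_inj_uniq ?enum_uniq // => x y /(inj_map val_inj); exact: val_inj.
- rewrite filter_uniq // map_inj_uniq ?enum_uniq // => x y /(inj_map val_inj).
  exact: val_inj.
move=> la; rewrite mem_filter; apply/mapP/andP => [[x]|[pla /mapP[x _ E]]].
  rewrite mem_enum inE => /andP[/and3P[sx x0 sn] hx] ->.
  by split; [rewrite /= sx hx x0 sn | exact: image_f].
rewrite {la}E in pla *; case/and3P: pla => /andP[sx hx] x0 sn.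
exists x; rewrite // mem_enum inE.
by rewrite /is_partition sx hx x0 sn.
Qed.

Lemma sorted_geq_nth la i j : sorted geq la -> (i <= j)%N -> (j < size la)%N ->
  (nth 0%N la j <= nth 0%N la i)%N.
Proof.
move=> sla ij jla.
have geqT : transitive geq by move=> x y z yx zx; apply: leq_trans yx.
apply: (sorted_leq_nth geqT (leqnn)) => //; rewrite inE //.
exact: leq_ltn_trans jla.
Qed.

Lemma leq_conj_part la m s : sorted geq la -> (s < size la)%N ->
  (m <= nth 0%N la s)%N -> (s < conj_part la m)%N.
Proof.
move=> sla sz ms; rewrite -[la](cat_take_drop s.+1) conj_part_cat.
have szt : size (take s.+1 la) = s.+1 by rewrite size_takel.
have -> : conj_part (take s.+1 la) m = s.+1.
  apply/eqP; rewrite -{2}szt -all_conj_part; apply/(all_nthP 0%N) => i.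
  rewrite szt => si; rewrite nth_take //.
  by apply: (leq_trans ms); apply: sorted_geq_nth.
exact: leq_addr.
Qed.

(** With [(s + r).+1] rows reaching column [m], the hook length at row [s.+1] is [k + r - m + 1];
    setting it equal to [s.+1 + h] gives the equation. *)
Lemma has_fixed_hookP m k h la : (0 < m <= k)%N ->
  reflect (exists s r, [/\ hooked m k s r la & s%:Z = r%:Z + k%:Z - h - m%:Z])
          (sorted geq la && has_fixed_hook m k h la).
Proof.
move=> /andP[m0 mk]; apply: (iffP idP).
  case/andP=> sla /hasP[[|s]]; rewrite mem_iota ?ltn0 // add1n ltnS => /andP[_ sz].
  rewrite /part /hook /part /= => /andP[/eqP nk /eqP hE].
  have lts := leq_conj_part la m s sla sz; rewrite nk in lts hE.
  (* The truncated subtraction is exact by [lts], since [m <= k]. *)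
  exists s, (conj_part la m - s.+1)%N; rewrite /hooked sla nk eqxx.
  by have := lts mk; split; [apply/eqP|]; lia.
case=> s [r [/and3P[sla /eqP nk /eqP cE] sE]]; rewrite sla.
have sz : (s < size la)%N.
  by rewrite ltnNge; apply/negP => /(nth_default 0%N); lia.
apply/hasP; exists s.+1; first by rewrite mem_iota add1n.
by rewrite /hook /part /= nk cE eqxx; apply/eqP; lia.
Qed.

(** The hook equation determines [s] from [r]. A negative [s] gives the empty class, mirroring the
    convention [1/(q;q)_j = 0] for [j < 0]. *)
Definition hooked_at m k (h : int) r la :=
  if r%:Z + k%:Z - h - m%:Z is Posz s then hooked m k s r la else false.

Lemma term2E m k h r : (0 < m <= k)%N ->
  term2 m k h r%:Z = gf (hooked_at m k h r).
Proof.
move=> mk; rewrite /term2 /hooked_at.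
case sE: (r%:Z + k%:Z - h - m%:Z) => [s|s]; last by rewrite gf0 ?mulr0 ?mul0r.
have hE : h = r%:Z + k%:Z - m%:Z - s%:Z by lia.
(* Eliminating [h] shows the exponent to be a natural number, so the integer power is an ordinary
   one. *)
have -> : r%:Z * (k%:Z + m%:Z) + k%:Z * (k%:Z - h - m%:Z + 1)
    = (k * s.+1 + m * r)%N%:Z.
  by rewrite hE PoszD !PoszM -addn1 PoszD; ring.
have -> : m%:Z - 1 = m.-1%:Z by lia.
have -> : r%:Z + k%:Z - m%:Z = (r + (k - m))%N%:Z by lia.
have -> : k%:Z - m%:Z = (k - m)%N%:Z by lia.
rewrite gf_hookedE // -exprnP /qbinom.
have -> : (0 <= (k - m)%N%:Z <= (r + (k - m))%N%:Z) by lia.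
have -> : (r + (k - m))%N%:Z - (k - m)%N%:Z = r%:Z by lia.
by rewrite /= [_ * _^-1 / qfact (k - m)]mulrAC.
Qed.

(** At most one [r] contributes: [conj_part la m] fixes [s + r] and the hook equation fixes [s - r].
    Moreover [r < conj_part la m <= size la], so stopping at [M] loses nothing. *)
Lemma has_fixed_hook_sum m k h la M : (0 < m <= k)%N -> (size la < M)%N ->
  (sorted geq la && has_fixed_hook m k h la : nat)
    = (\sum_(r < M) hooked_at m k h r la)%N.
Proof.
move=> mk szM; case: (has_fixed_hookP m k h la mk) => [[s [r [hk sE]]]|nP].
  have rM : (r < M)%N.
    apply: leq_ltn_trans szM; apply: leq_trans (count_size (leq m) la).
    by case/and3P: hk => _ _ /eqP; rewrite /conj_part => ->; lia.
  rewrite (bigD1 (Ordinal rM)) //= {1}/hooked_at.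
  have -> : r%:Z + k%:Z - h - m%:Z = s%:Z by lia.
  rewrite hk big1 // => i /eqP ni; rewrite /hooked_at.
  case s'E: (_ - _) => [s'|] //.
  case: (boolP (hooked _ _ _ _ _)) => // /and3P[_ _ /eqP cE]; case: ni.
  by apply: val_inj => /=; case/and3P: hk => _ _ /eqP; lia.
rewrite big1 // => r _; rewrite /hooked_at; case sE: (_ - _) => [s|] //.
by case: (boolP (hooked _ _ _ _ _)) => // hk; case: nP; exists s, r; rewrite hk sE.
Qed.

Lemma term1_shift m k h (i : nat) :
  term1 m k h (k%:Z - h - m%:Z + 1 + i%:Z) = term2 m k h i%:Z.
Proof.
rewrite /term1 /term2.
congr ('q ^ _ * inv_qpoch _ * inv_qpoch _ * qbinom _ _); first by ring.
  by ring.
by ring.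
Qed.

Theorem theorem2p2 (m k : nat) (h : int) (hm : (1 <= m)%N) (hk : (m <= k)%N) :
  fps_sums_to (fun i : nat => term1 m k h (k%:Z - h - m%:Z + 1 + i%:Z))
              (fixed_hook_gf m k h) /\
  fps_sums_to (fun s : nat => term2 m k h s%:Z)
              (fixed_hook_gf m k h).
Proof.
have mk : (0 < m <= k)%N by rewrite hm.
have sums2 : fps_sums_to (fun s : nat => term2 m k h s%:Z) (fixed_hook_gf m k h).
  (* A partition of [n] has at most [n] parts, so [n.+1] terms suffice for coefficient [n]. *)
  move=> n; exists n.+1 => M nM; rewrite fixed_hook_gfE.
  have coefs_sum : coefs (\sum_(i < M) term2 m k h i%:Z) n
      = \sum_(i < M) coefs (term2 m k h i%:Z) n.
    by apply: (big_morph (fun f : fps int => coefs f n)).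
  rewrite coefs_sum; under eq_bigr => i _ do rewrite term2E //=.
  rewrite -(big_morph Posz PoszD (erefl _)) /=; congr Posz.
  under eq_bigr => i _ do rewrite -sum1_count big_mkcond.
  (* Summing over [r] first reduces the claim to one indicator identity per composition. *)
  rewrite exchange_big -sum1_count [RHS]big_mkcond big_seq [RHS]big_seq /=.
  apply: eq_bigr => la; rewrite mem_comps => /andP[la0 /eqP sla].
  rewrite -[RHS]/(nat_of_bool (sorted geq la && has_fixed_hook m k h la)).
  rewrite (has_fixed_hook_sum m k h la M) //.
  by apply: leq_ltn_trans nM; rewrite -sla leq_size_sumn.
split=> // n; have [N sumN] := sums2 n; exists N => M /sumN <-.
by under eq_bigr => i _ do rewrite term1_shift.
Qed.
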